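(* Let $m_1,\dots,m_k$ be positive integers with $\sum_{i=1}^k 1/m_i=1$. Then there exist integers $r_1,\dots,r_k$ such that $((m_1,r_1),\dots,(m_k,r_k))$ is a disjoint covering system if and only if $(m_1,\dots,m_k)$ is good.
   Context: A list of pairs of integers $((m_1,r_1),\dots,(m_k,r_k))$ with $m_i\ge1$ is a disjoint covering system if for every integer $x$ there is exactly one $i$ with $x\equiv r_i\pmod{m_i}$. A tuple $(a_1,\dots,a_k)$ of positive integers is good if there are sets $S_1,\dots,S_k\subseteq\mathbb{R}$ such that any two distinct elements of $S_i$ differ by at least $a_i$ and every integer belongs to $S_1\cup\dots\cup S_k$; otherwise it is bad. *)

(* Defs.v *)
From HB Require Import structures.
From mathcomp Require Import all_boot all_order all_algebra.
From mathcomp Require Import classical_sets reals.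

Set Implicit Arguments.
Unset Strict Implicit.
Unset Printing Implicit Defensive.

Import Order.TTheory GRing.Theory Num.Theory.
Local Open Scope classical_set_scope.
Local Open Scope ring_scope.

(* [c i] is the pair (m_i, r_i) of a modulus and a residue. *)
Definition disjoint_covering_system (k : nat) (c : 'I_k -> int * int) : Prop :=
  (forall i : 'I_k, 1 <= (c i).1) /\
  (forall x : int, exists! i : 'I_k, (x = (c i).2 %[mod (c i).1])%Z).

Definition good (R : realType) (k : nat) (a : 'I_k -> int) : Prop :=
  (forall i : 'I_k, 0 < a i) /\
  exists S : 'I_k -> set R,
    (forall (i : 'I_k) (x y : R),
       S i x -> S i y -> x <> y -> (a i)%:~R <= `|x - y|) /\
    (forall n : int, exists i : 'I_k, S i n%:~R).

(* Main.v *)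
Require Import Defs.
From HB Require Import structures.
From mathcomp Require Import all_boot all_order all_algebra.
From mathcomp Require Import boolp classical_sets reals.
From mathcomp Require Import zify.

(** Let L be the product of the moduli.  A set of integers whose gaps are at
    least m has at most one element among any m consecutive integers, hence at
    most L / m among any L consecutive ones.  These bounds sum to exactly L, so
    a cover of the integers by such sets attains all of them: the sets are
    pairwise disjoint, and the i-th one meets every block of m_i consecutive
    integers exactly once, i.e. it is a residue class modulo m_i. *)

Set Implicit Arguments.
Unset Strict Implicit.
Unset Printing Implicit Defensive.

Import Order.TTheory GRing.Theory Num.Theory.
Local Open Scope ring_scope.

Definition window_count (t : int -> bool) (x : int) (N : nat) : nat :=
  (\sum_(j < N) t (x + j%:Z)%R)%N.

Definition separated (n : nat) (t : int -> bool) : Prop :=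
  forall x y, t x -> t y -> x <> y -> n%:Z <= `|x - y|.

Lemma window_countD t x a b :
  window_count t x (a + b) =
  (window_count t x a + window_count t (x + a%:Z) b)%N.
Proof.
rewrite /window_count big_split_ord /=; congr addn.
by apply: eq_bigr => j _; rewrite PoszD addrA.
Qed.

Lemma window_count1 t x : window_count t x 1 = t x.
Proof. by rewrite /window_count big_ord1 addr0. Qed.

Section Separated.
Variables (n : nat) (t : int -> bool).
Hypothesis sep : separated n t.

Lemma window_count_le1 x : (window_count t x n <= 1)%N.
Proof.
rewrite /window_count -big_mkcond sum1_card; apply/card_le1_eqP => i j.
rewrite !unfold_in => ti tj; apply/eqP/negP => /negP ne_ij.
have ne : x + i%:Z <> x + j%:Z.
  by move=> /addrI [] eq_ij; case/eqP: ne_ij; apply: val_inj.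
have := sep ti tj ne; have := ltn_ord i; have := ltn_ord j; lia.
Qed.

Lemma window_count_mul x q : (window_count t x (q * n) <= q)%N.
Proof.
elim: q x => [|q IHq] x; first by rewrite mul0n /window_count big_ord0.
by rewrite mulSn window_countD -add1n leq_add ?window_count_le1.
Qed.

(** The window splits into its first block of length [n], holding at most 1 element, and [q - 1]
    further blocks, holding at most [q - 1]; a total of [q] leaves no slack in the first. *)
Lemma window_count_full x q :
  (0 < q)%N -> window_count t x (q * n) = q -> window_count t x n = 1%N.
Proof.
case: q => // q _; rewrite mulSn window_countD.
have := window_count_le1 x; have := window_count_mul (x + n%:Z) q; lia.
Qed.

Hypothesis n_gt0 : (0 < n)%N.
Hypothesis full : forall x, window_count t x n = 1%N.

(** The windows of length [n] at [x] and [x + 1] share [n - 1] positions and have equal counts, so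
    the two positions they do not share agree. *)
Lemma full_shift x : t (x + n%:Z) = t x.
Proof.
have := window_countD t x 1 n.-1; have := window_countD t (x + 1%:Z) n.-1 1.
rewrite add1n addn1 prednK // !full !window_count1 -addrA.
have -> : 1%:Z + n.-1%:Z = n%:Z by lia.
by case: (t x); case: (t (x + n%:Z)); lia.
Qed.

Lemma full_shiftz x (z : int) : t (x + z * n%:Z) = t x.
Proof.
elim/int_rect: z => [|q IHq|q IHq]; first by rewrite mul0r addr0.
- by rewrite -IHq -(full_shift (x + q%:Z * n%:Z)); congr t; lia.
- by rewrite -IHq -(full_shift (x + - q.+1%:Z * n%:Z)); congr t; lia.
Qed.

Lemma full_residue_class :
  exists r : int, forall x, (x = r %[mod n%:Z])%Z <-> t x.
Proof.
(* Any element serves as the residue; one exists because the window at 0 is not empty. *)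
have [r tr] : exists r, t r.
  apply: contrapT => /forallNP nt; have := full 0.
  by rewrite /window_count big1 // => j _; case: (t _) (nt (0 + j%:Z)) => //; case.
exists r => x; split.
  move=> /eqP; rewrite eqz_mod_dvd => /dvdzP[z /eqP].
  by rewrite subr_eq addrC => /eqP ->; rewrite full_shiftz.
have n0 : n%:Z != 0 by lia.
move=> tx; have modlt := ltz_mod (x - r) n0; have modge := modz_ge0 (x - r) n0.
have E := divz_eq (x - r) n%:Z.
set z := divz (x - r) n%:Z in E.
(* By periodicity [x] moves to [r + (x - r) mod n], which is less than [n] away from [r]; separation
   then forces it to equal [r]. *)
have tx' : t (x + (- z) * n%:Z) by rewrite full_shiftz.
apply/eqP; rewrite eqz_mod_dvd; apply/dvdzP; exists z.
have [eq_r|ne] := eqVneq (x + (- z) * n%:Z) r; first by rewrite -{1}eq_r; lia.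
by have := sep tx' tr (elimN eqP ne); lia.
Qed.

End Separated.

Lemma eq_sum_le (I : finType) (E1 E2 : I -> nat) :
  (forall i, E1 i <= E2 i)%N -> (\sum_i E2 i <= \sum_i E1 i)%N -> E1 =1 E2.
Proof.
move=> le12 le21 i.
have /leqifP := @leqif_sum _ xpredT (fun i => E1 i == E2 i) E1 E2
  (fun i _ => leqif_eq (le12 i)).
case: ifP => [/forallP/(_ i)/eqP //|_]; lia.
Qed.

Lemma sum_divn_inv (I : finType) (n : I -> nat) (L : nat) :
  (forall i, 0 < n i)%N -> (forall i, n i %| L)%N ->
  \sum_i ((n i)%:R : rat)^-1 = 1 -> (\sum_i L %/ n i)%N = L.
Proof.
move=> n_gt0 n_dvd sum1; apply/eqP; rewrite -(eqr_nat rat) natr_sum.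
have <- : L%:R * \sum_i ((n i)%:R : rat)^-1 = L%:R by rewrite sum1 mulr1.
rewrite mulr_sumr; apply/eqP/eq_bigr => i _.
have n0 : (n i)%:R != 0 :> rat by rewrite pnatr_eq0 -lt0n.
by rewrite -{2}(divnK (n_dvd i)) natrM mulfK.
Qed.

Section Tight.
Variables (I : finType) (n : I -> nat) (t : I -> int -> bool).
Hypothesis n_gt0 : forall i, (0 < n i)%N.
Hypothesis sum_inv : \sum_i ((n i)%:R : rat)^-1 = 1.
Hypothesis sep : forall i, separated (n i) (t i).
Hypothesis cover : forall x, exists i, t i x.

Let L : nat := (\prod_i n i)%N.

Let n_dvd i : (n i %| L)%N.
Proof. by rewrite /L (bigD1 i) //= dvdn_mulr. Qed.

Let L_gt0 : (0 < L)%N.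
Proof. by rewrite prodn_gt0. Qed.

Let cover_ge1 x : (1 <= \sum_i t i x)%N.
Proof. by have [i ti] := cover x; rewrite (bigD1 i) //= ti. Qed.

Let window_sum x :
  (\sum_i window_count (t i) x L)%N = (\sum_(j < L) \sum_i t i (x + j%:Z)%R)%N.
Proof. by rewrite /window_count exchange_big. Qed.

Let window_sum_ge x : (L <= \sum_i window_count (t i) x L)%N.
Proof.
by rewrite window_sum -[X in (X <= _)%N]card_ord -sum1_card leq_sum.
Qed.

Let window_le i x : (window_count (t i) x L <= L %/ n i)%N.
Proof. by rewrite -{1}(divnK (n_dvd i)) window_count_mul. Qed.

(** The counts over a window of length [L] sum to at least [L] by covering, while their bounds
    [L %/ n i] sum to [L]. Hence every bound is attained, and [window_count_full] passes to the
    first block. *)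
Lemma tight_full i x : window_count (t i) x (n i) = 1%N.
Proof.
apply: (window_count_full (@sep i) (q := (L %/ n i)%N)).
  by rewrite divn_gt0 // dvdn_leq.
rewrite divnK //.
apply: (eq_sum_le (E2 := fun i => (L %/ n i)%N) (fun i => window_le i x)).
by rewrite sum_divn_inv.
Qed.

(** The same double count, read by positions: each of the [L] positions is covered at least once and
    the total is at most [L], so each is covered exactly once, in particular position 0, which is
    [x]. *)
Lemma tight_disjoint x i j : t i x -> t j x -> i = j.
Proof.
move=> ti tj.
have := eq_sum_le (E1 := fun=> 1%N)
  (E2 := fun l : 'I_L => (\sum_i t i (x + l%:Z)%R)%N) (fun l => cover_ge1 _).
rewrite -window_sum sum1_card card_ord => /(_ _ (Ordinal L_gt0)) /=.
rewrite addr0 => E; apply/eqP/negP => /negP ne.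
have : (1 = \sum_i t i x)%N.
  (* Writing [L] as the sum of the [L %/ n i] lets the total be bounded index by index. *)
  by apply: E; rewrite -[leqRHS](sum_divn_inv n_gt0 n_dvd sum_inv) leq_sum.
by rewrite (bigD1 i) //= (bigD1 j) 1?eq_sym //= ti tj.
Qed.

End Tight.

Lemma covering_system_good (R : realType) (k : nat) (m r : 'I_k -> int) :
  (forall i, 0 < m i) -> disjoint_covering_system (fun i => (m i, r i)) ->
  good R m.
Proof.
move=> m_gt0 [_ cov]; split=> //.
(* Each set is a residue class embedded in [R]; distinct members differ by a nonzero multiple of
   [m i]. *)
exists (fun i => [set x : R | exists2 z : int,
  x = z%:~R & (z = r i %[mod m i])%Z]%classic); split; last first.
  by move=> z; have [i [zi _]] := cov z; exists i, z.
move=> i _ _ [y -> yr] [z -> zr] ne; rewrite -intrB -intr_norm ler_int.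
have /eqP : (y = z %[mod m i])%Z by rewrite yr zr.
rewrite eqz_mod_dvd dvdzE => /dvdn_leq.
have ne_yz : y <> z by move=> eq_yz; apply: ne; rewrite eq_yz.
by have := m_gt0 i; lia.
Qed.

Theorem theorem9 (R : realType) (k : nat) (m : 'I_k -> int)
    (m_gt0 : forall i : 'I_k, 0 < m i)
    (sum_inv : \sum_(i < k) ((m i)%:~R : rat)^-1 = 1) :
  (exists r : 'I_k -> int, disjoint_covering_system (fun i => (m i, r i))) <->
  good R m.
Proof.
split=> [[r]|[_ [S [sepS covS]]]]; first exact: covering_system_good.
(* Only the integer points of each [S i] matter; classical decidability turns membership into a
   boolean that can be counted. *)
pose n i := `|m i|%N; pose t i (x : int) := `[< S i x%:~R >].
have mE i : m i = n i by rewrite /n gtz0_abs.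
have n_gt0 i : (0 < n i)%N by rewrite absz_gt0 gt_eqF.
have sum_n : \sum_i ((n i)%:R : rat)^-1 = 1.
  by rewrite -[RHS]sum_inv; apply: eq_bigr => i _; rewrite mE.
have sep i : separated (n i) (t i).
  move=> x y /asboolP Sx /asboolP Sy ne.
  rewrite -mE -(ler_int R) intr_norm intrB; apply: (sepS i) => //.
  by move=> /intr_inj.
have cover x : exists i, t i x by have [i Si] := covS x; exists i; apply/asboolP.
have /choice[r rP] : forall i, exists r : int,
    forall x, (x = r %[mod m i])%Z <-> t i x.
  move=> i; rewrite mE; apply: full_residue_class => // x.
  exact: tight_full.
exists r; split=> [i|x] /=; first by rewrite -gtz0_ge1.
have [i ti] := cover x; exists i; split; first exact/rP.
by move=> j /rP tj; apply: (tight_disjoint n_gt0 sum_n sep cover ti tj).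
Qed.
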